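(* Let $D=(V,A)$ be a finite loopless digraph endowed with lower and upper bound functions $f:A\rightarrow \mathbb{Z}\cup\{-\infty\}$ and $g:A\rightarrow \mathbb{Z}\cup\{+\infty\}$ with $f\leq g$. Let $B\subseteq\mathbb{R}^V$ be an integral base-polyhedron for which the base-flow polyhedron $Q=Q(f,g;B)$ is non-empty. Let $F\subseteq A$ be a specified subset of edges such that both $f$ and $g$ are finite-valued on $F$. Then there exist a face $B^{\triangledown}$ of $B$ and a pair $(f^{*},g^{*})$ of integer-valued bounding functions on $A$ with $f\leq f^{*}\leq g^{*}\leq g$ such that an element $z\in Q\cap\mathbb{Z}^A$ is $F$-dec-min in $Q\cap\mathbb{Z}^A$ if and only if $z\in Q(f^{*},g^{*};B^{\triangledown})\cap\mathbb{Z}^A$. Moreover, $0\leq g^{*}(e)-f^{*}(e)\leq 1$ for every $e\in F$.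
   Context: For $x\in\mathbb{R}^V$ and $Z\subseteq V$ write $\widetilde x(Z)=\sum_{v\in Z}x(v)$. A set function $p:2^V\to\mathbb{Z}\cup\{-\infty\}$ with $p(\emptyset)=0$ is (fully) supermodular if $p(X)+p(Y)\le p(X\cap Y)+p(X\cup Y)$ for all $X,Y\subseteq V$. For such $p$ with $p(V)$ finite, $B'(p)=\{x\in\mathbb{R}^V:\widetilde x(V)=p(V),\ \widetilde x(Z)\ge p(Z)\text{ for all }Z\subset V\}$ is a base-polyhedron; it is integral when $p$ is integer-valued wherever finite (the empty set is also regarded as a base-polyhedron). For $x:A\to\mathbb{R}$ the net in-flow is $\psi_x(v)=\sum_{uv\in A}x(uv)-\sum_{vu\in A}x(vu)$ for $v\in V$. The base-flow polyhedron is $Q(f,g;B)=\{x\in\mathbb{R}^A: f\le x\le g,\ \psi_x\in B\}$. For $y,y'\in\mathbb{R}^F$, $y$ is decreasingly smaller than $y'$ if the sequence of components of $y$ sorted in decreasing order is lexicographically smaller than that of $y'$. For a set $S\subseteq\mathbb{R}^A$, an element $z\in S$ is $F$-dec-min in $S$ if no $z'\in S$ has restriction $z'|_F$ decreasingly smaller than $z|_F$. *)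

(* Defs.v *)
From HB Require Import structures.
From mathcomp Require Import all_boot all_order all_algebra.
From mathcomp Require Import boolp classical_sets reals constructive_ereal.

Set Implicit Arguments.
Unset Strict Implicit.
Unset Printing Implicit Defensive.

Import Order.TTheory GRing.Theory Num.Theory.
Local Open Scope classical_set_scope.
Local Open Scope ring_scope.

(* Values in Z ∪ {-oo} and Z ∪ {+oo} are elements of \bar int from which +oo,
   respectively -oo, is excluded. *)
Definition below_pinfty (T : Type) (h : T -> \bar int) : Prop :=
  forall t, h t <> +oo%E.
Definition above_ninfty (T : Type) (h : T -> \bar int) : Prop :=
  forall t, h t <> -oo%E.

Section BasePolyhedra.
Context {R : realType} {V : finType}.

Definition supermodular (p : {set V} -> \bar int) : Prop :=
  forall X Y : {set V}, (p X + p Y <= p (X :&: Y)%SET + p (X :|: Y)%SET)%E.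

Definition base_polyhedron (p : {set V} -> \bar int) : set {ffun V -> R} :=
  [set x | (\sum_v x v)%:E = er_map intr (p [set: V]%SET) /\
    forall Z : {set V}, Z \proper [set: V]%SET ->
      (er_map intr (p Z) <= (\sum_(v in Z) x v)%:E)%E].

Definition integral_base_polyhedron (B : set {ffun V -> R}) : Prop :=
  B = set0 \/
  exists p : {set V} -> \bar int,
    [/\ below_pinfty p, p finset.set0 = 0%E, p [set: V]%SET \is a fin_num,
        supermodular p & B = base_polyhedron p].

(* Faces are the non-empty intersections of B with a supporting hyperplane
   (c = 0 gives B itself). *)
Definition face (B C : set {ffun V -> R}) : Prop :=
  C !=set0 /\
  exists c : {ffun V -> R},
    C = [set x | B x /\
           forall y, B y -> \sum_v c v * x v <= \sum_v c v * y v].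

End BasePolyhedra.

Section BaseFlows.
Context {R : realType} {V A : finType}.

(* The edge e goes from src e to tgt e; parallel edges are allowed. *)
Definition net_inflow (src tgt : A -> V) (x : {ffun A -> R}) : {ffun V -> R} :=
  [ffun v => \sum_(e | tgt e == v) x e - \sum_(e | src e == v) x e].

Definition base_flow (src tgt : A -> V) (f g : A -> \bar int)
    (B : set {ffun V -> R}) : set {ffun A -> R} :=
  [set x : {ffun A -> R} | (forall e, er_map intr (f e) <= (x e)%:E <= er_map intr (g e))%E /\
           B (net_inflow src tgt x)].

Definition integral_points : set {ffun A -> R} :=
  [set x : {ffun A -> R} | forall e, x e \is a Num.int].

Definition sorted_decr (F : {set A}) (x : {ffun A -> R}) : seqlexi R :=
  sort >=%R [seq x e | e <- enum F].

(* The order on seqlexi R is the lexicographic one; both sequences have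
   length #|F|. *)
Definition dec_smaller (F : {set A}) (x y : {ffun A -> R}) : Prop :=
  (sorted_decr F x < sorted_decr F y)%O.

Definition dec_min (F : {set A}) (S : set {ffun A -> R}) : set {ffun A -> R} :=
  [set z | S z /\ forall z', S z' -> ~ dec_smaller F z' z].

End BaseFlows.

(* Main.v *)
Require Import Defs.
From HB Require Import structures.
From mathcomp Require Import all_boot all_order all_algebra.
From mathcomp Require Import boolp classical_sets reals constructive_ereal.
From mathcomp Require Import zify ring.

Set Implicit Arguments.
Unset Strict Implicit.
Unset Printing Implicit Defensive.

Import Order.TTheory GRing.Theory Num.Theory.
Local Open Scope classical_set_scope.
Local Open Scope ring_scope.

(** With [N > #|F| + 1] and a common lower bound [L] of [f] on [F], comparing
    two elements of [Q] decreasingly on [F] amounts to comparing the separable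
    strictly convex costs [\sum_(e in F) N ^ (z e - L)].  At an integral
    optimum [z0] the residual digraph, which has besides the usual arcs an arc
    of cost zero for every exchange [x + chi_u - chi_v] possible in [B] at the
    net in-flow [x] of [z0], contains no negative closed walk: one with fewest
    arcs has so few chords that its exchanges can be performed one after the
    other, giving a cheaper integral flow.  Hence there is an integral potential
    [pi].  Its level sets are tight, so [x] minimizes [pi] over [B], and the
    minimizers form the face.  The optimal [z] are those whose net in-flow lies
    in this face and whose values minimize the reduced cost of each edge, and
    the minimizers of a strictly convex function on an integer interval are at
    most two consecutive integers. *)

(** * Walks in a weighted digraph, potentials, and negative closed walks with fewest arcs *)

Section Walks.
Variables (V E : finType) (tl hd : E -> V) (w : E -> int) (P : pred E).

Fixpoint walk (u : V) (s : seq E) (v : V) : bool :=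
  if s is e :: s' then [&& P e, tl e == u & walk (hd e) s' v] else u == v.

Lemma walk_cat u s1 s2 v :
  walk u (s1 ++ s2) v <-> exists2 m, walk u s1 m & walk m s2 v.
Proof.
elim: s1 u => [|e s1 IH] u /=.
  by split=> [h|[m /eqP-> //]]; exists u.
split=> [/and3P[-> -> /IH[m h1 h2]]|[m /and3P[-> -> h1] h2]].
  by exists m.
by apply/IH; exists m.
Qed.

Lemma walk_all u s v : walk u s v -> all P s.
Proof. by elim: s u => //= e s IH u /and3P[-> _ /IH]. Qed.

Definition cost (s : seq E) : int := \sum_(e <- s) w e.

Lemma cost_cat s1 s2 : cost (s1 ++ s2) = cost s1 + cost s2.
Proof. exact: big_cat. Qed.

Lemma cost_cons e s : cost (e :: s) = w e + cost s.
Proof. exact: big_cons. Qed.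

Lemma cost_nil : cost [::] = 0.
Proof. exact: big_nil. Qed.

Definition costE := (cost_cat, cost_cons, cost_nil).

Definition conservative := forall u s, walk u s u -> 0 <= cost s.

Lemma not_uniq_split (s : seq E) : ~~ uniq s ->
  exists s1 e s2 s3, s = s1 ++ e :: s2 ++ e :: s3.
Proof.
elim: s => //= e s IH; rewrite negb_and negbK => /orP[|/IH].
  by case/splitPr=> s2 s3; exists [::], e, s2, s3.
by move=> [s1 [e' [s2 [s3 ->]]]]; exists (e :: s1), e', s2, s3.
Qed.

(** Cutting out the closed subwalk between two occurrences of an arc does not raise the cost, so
    walks with distinct arcs suffice. The bound makes least costs of walks exist. *)
Lemma walk_cost_ge u s v : conservative -> walk u s v ->
  - (\sum_e `|w e|) <= cost s.
Proof.
move=> cons; have [n] := ubnP (size s); elim: n s => // n IH s /ltnSE szs ws.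
have [us|/not_uniq_split[s1 [e [s2 [s3 def_s]]]]] := boolP (uniq s).
  rewrite /cost lerNl -sumrN big_uniq //=.
  apply: (@le_trans _ _ (\sum_(e in s) `|w e|)).
    by apply: ler_sum => e _; rewrite -normrN ler_norm.
  rewrite big_mkcond; apply: ler_sum => e _.
  by case: ifP => _; rewrite ?normr_ge0.
move: ws; rewrite def_s => /walk_cat[m w1 /= /and3P[Pe /eqP tle]].
move=> /walk_cat[m' w2 /= /and3P[_ /eqP tle' w3]]; rewrite tle in tle'; subst m'.
have w13 : walk u (s1 ++ e :: s3) v.
  by apply/walk_cat; exists m => //=; rewrite Pe tle eqxx.
have := IH _ _ w13; rewrite !costE.
have := cons m (e :: s2); rewrite /= Pe tle eqxx w2 costE => /(_ isT).
have : (size (s1 ++ e :: s3) < n)%N.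
  by move: szs; rewrite def_s !size_cat /= size_cat /=; lia.
by move=> -> h1 /(_ isT) h2; lia.
Qed.

Lemma int_min_exists (T : Type) (Q : T -> Prop) (h : T -> int) (b : int) :
  (exists t, Q t) -> (forall t, Q t -> b <= h t) ->
  exists2 t, Q t & forall t', Q t' -> h t <= h t'.
Proof.
move=> [t0 Qt0] hb.
pose q n := `[< exists2 t, Q t & absz (h t - b) = n >].
have exq : exists n, q n by exists (absz (h t0 - b)); apply/asboolP; exists t0.
have [n /asboolP[t Qt def_n] min_n] := ex_minnP exq.
exists t => // t' Qt'.
have /min_n : q (absz (h t' - b)) by apply/asboolP; exists t'.
by rewrite -def_n; have := hb _ Qt; have := hb _ Qt'; lia.
Qed.

(** Take for [pi v] the least cost of a walk ending in [v] from any start, as if an extra source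
    reached every vertex at cost zero; appending [e] to a cheapest walk to [tl e] gives the
    inequality. *)
Lemma potential_exists : conservative ->
  exists pi : V -> int, forall e, P e -> pi (hd e) <= pi (tl e) + w e.
Proof.
move=> cons.
have min_walk v : exists2 s, (exists u, walk u s v) &
    forall s', (exists u, walk u s' v) -> cost s <= cost s'.
  apply: (@int_min_exists _ _ _ (- (\sum_e `|w e|))).
    by exists [::], v => /=.
  by move=> s [u ws]; apply: walk_cost_ge ws.
pose best v := projT1 (cid2 (min_walk v)).
have bestP v : (exists u, walk u (best v) v) /\
    forall s', (exists u, walk u s' v) -> cost (best v) <= cost s'.
  by rewrite /best; case: cid2.
exists (fun v => cost (best v)) => e Pe.
have [[u wu] _] := bestP (tl e).
have := (bestP (hd e)).2 (rcons (best (tl e)) e).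
rewrite -cats1 !costE addr0; apply; exists u; apply/walk_cat.
by exists (tl e) => //=; rewrite Pe !eqxx.
Qed.

Lemma minimal_negative_walk : ~ conservative ->
  exists u s, [/\ walk u s u, cost s < 0 &
    forall u' s', walk u' s' u' -> (size s' < size s)%N -> 0 <= cost s'].
Proof.
move=> ncons.
pose q n := `[< exists u s, [/\ walk u s u, cost s < 0 & size s = n] >].
have exq : exists n, q n.
  apply: contrapT => nq; apply: ncons => u s ws; rewrite leNgt; apply/negP => neg.
  by apply: nq; exists (size s); apply/asboolP; exists u, s.
have [n /asboolP[u [s [ws neg szs]]] min_n] := ex_minnP exq.
exists u, s; split=> // u' s' ws' lt_s; rewrite leNgt; apply/negP => neg'.
have : q (size s') by apply/asboolP; exists u', s'.
by move=> /min_n; lia.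
Qed.

(** A repeated arc would split the closed walk into two shorter closed walks with the same total
    cost, one of them negative. *)
Lemma minimal_negative_uniq u s : walk u s u -> cost s < 0 ->
  (forall u' s', walk u' s' u' -> (size s' < size s)%N -> 0 <= cost s') ->
  uniq s.
Proof.
move=> ws neg min_s; apply/negPn/negP => /not_uniq_split[s1 [e [s2 [s3 def_s]]]].
move: ws neg; rewrite def_s => /walk_cat[m w1 /= /and3P[Pe /eqP tle]].
move=> /walk_cat[m' w2 /= /and3P[_ /eqP tle' w3]]; rewrite tle in tle'; subst m'.
have w13 : walk u (s1 ++ e :: s3) u.
  by apply/walk_cat; exists m => //=; rewrite Pe tle eqxx.
have w2c : walk m (e :: s2) m by rewrite /= Pe tle eqxx w2.
have := min_s _ _ w13; have := min_s _ _ w2c.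
rewrite def_s !size_cat /= !size_cat /= !costE; move: (size s1) => *.
by lia.
Qed.

Lemma sum_walk (G : zmodType) (h : V -> G) u s v : walk u s v ->
  \sum_(e <- s) (h (hd e) - h (tl e)) = h v - h u.
Proof.
elim: s u => /= [u /eqP->|e s IH u /and3P[_ /eqP <- /IH]]; first by rewrite big_nil subrr.
by rewrite big_cons => ->; rewrite addrC subrKA.
Qed.

End Walks.

(** * Tight sets and exchanges at an integral base *)

Section IntegralBases.
Variables (V : finType) (p : {set V} -> \bar int).
Hypothesis p_super : supermodular p.
Implicit Types (x : V -> int) (Z : {set V}) (u v : V).

Definition bsum x Z : int := \sum_(v in Z) x v.

Definition tight x Z : bool := p Z == (bsum x Z)%:E.

Definition int_base x : Prop :=
  tight x finset.setT /\ forall Z, (p Z <= (bsum x Z)%:E)%E.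

(* [u] lies in every tight set containing [v], so one unit of [x] may be moved
   from [v] to [u]. *)
Definition exch x v u : bool :=
  [forall Z : {set V}, tight x Z ==> (v \in Z) ==> (u \in Z)].

Lemma bsum_cap_cup x (X Y : {set V}) :
  bsum x (X :&: Y)%SET + bsum x (X :|: Y)%SET = bsum x X + bsum x Y.
Proof.
rewrite /bsum ![\sum_(v in _) _]big_mkcond -!big_split /=; apply: eq_bigr => v _.
by rewrite !inE; case: (v \in X); case: (v \in Y); rewrite ?addr0 ?add0r.
Qed.

(** Uncrossing: [bsum x] is modular and dominates [p], so supermodularity forces equality on both
    the intersection and the union. *)
Lemma tight_cap_cup x (X Y : {set V}) : int_base x -> tight x X -> tight x Y ->
  tight x (X :&: Y)%SET && tight x (X :|: Y)%SET.
Proof.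
move=> [_ le_p] /eqP tX /eqP tY.
have := p_super X Y; rewrite tX tY /tight.
have := le_p (X :&: Y)%SET; have := le_p (X :|: Y)%SET.
have := bsum_cap_cup x X Y.
case: (p (X :&: Y)%SET) => [a| |]; case: (p (X :|: Y)%SET) => [b| |] //=.
by rewrite -!EFinD !lee_fin => ? ? ? ?; rewrite !eqe; apply/andP; split; lia.
Qed.

Lemma slack x Z : int_base x -> ~~ tight x Z -> (p Z <= (bsum x Z - 1)%:E)%E.
Proof.
move=> [_ /(_ Z)]; rewrite /tight; case: (p Z) => [a| |] /=.
  by rewrite !lee_fin eqe; lia.
  by rewrite leye_eq.
by rewrite !leNye.
Qed.

(** By uncrossing, the intersection of all tight sets containing [v] is tight; its elements are the
    vertices that may receive a unit from [v]. *)
Lemma minimal_tight x v : int_base x ->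
  exists2 M : {set V}, tight x M & forall u, (u \in M) = exch x v u.
Proof.
move=> xB; exists (\bigcap_(Z | tight x Z && (v \in Z)) Z)%SET.
  apply: (@big_ind _ (fun Z => is_true (tight x Z))); first exact: xB.1.
    by move=> X Y tX tY; have /andP[] := tight_cap_cup xB tX tY.
  by move=> Z /andP[].
move=> u; apply/finset.bigcapP/forallP => [h Z|h Z /andP[tZ vZ]].
  by apply/implyP => tZ; apply/implyP => vZ; apply: h; rewrite tZ vZ.
by have := h Z; rewrite tZ vZ.
Qed.

Lemma exch_refl x v : exch x v v.
Proof. by apply/forallP => Z; apply/implyP => _; apply/implyP. Qed.

Definition shift x u v : V -> int := fun t => x t + ((t == u)%:Z - (t == v)%:Z).

Lemma bsum_indic u Z : \sum_(t in Z) (t == u)%:Z = (u \in Z)%:Z.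
Proof.
have [uZ|uZ] := boolP (u \in Z).
  rewrite (bigD1 u) //= eqxx big1 ?addr0 // => t /andP[_ /negPf->] //.
by rewrite big1 // => t tZ; case: eqP => // tu; rewrite -tu tZ in uZ.
Qed.

Lemma bsum_shift x u v Z :
  bsum (shift x u v) Z = bsum x Z + ((u \in Z)%:Z - (v \in Z)%:Z).
Proof. by rewrite /bsum /shift big_split sumrB !bsum_indic. Qed.

(** A tight set containing [v] contains [u] and loses nothing; any other set has, by integrality, a
    slack of at least one. *)
Lemma shift_base x u v : int_base x -> exch x v u -> int_base (shift x u v).
Proof.
move=> xB /forallP vu; split; first by rewrite /tight bsum_shift !inE subrr addr0 (eqP xB.1).
move=> Z; rewrite bsum_shift.
have [tZ|/(slack xB) h] := boolP (tight x Z).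
  have := vu Z; rewrite tZ /=; move: (eqP tZ) => ->; rewrite lee_fin.
  by case: (v \in Z); case: (u \in Z) => //= _; rewrite lerDl.
by apply: (le_trans h); rewrite lee_fin; case: (v \in Z); case: (u \in Z); lia.
Qed.

(** The minimal tight set [M] of [v'] avoids [u], hence also [v]. So the shift changes no sum inside
    [M], and intersecting with [M] turns any tight set containing [v'] into one inside [M]. *)
Lemma exch_shift x u v v' t : int_base x -> exch x v u -> ~~ exch x v' u ->
  exch (shift x u v) v' t = exch x v' t.
Proof.
move=> xB vu nv'u; have x1B := shift_base xB vu.
have [M tM inM] := minimal_tight v' xB.
have uM : u \notin M by rewrite inM.
have vM : v \notin M.
  by apply/negP => vM; move: vu => /forallP/(_ M); rewrite tM vM (negPf uM).
have tight_in Z : Z \subset M -> tight (shift x u v) Z = tight x Z.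
  move=> /fintype.subsetP ZM; rewrite /tight bsum_shift.
  have /negPf-> : u \notin Z by apply/negP => /ZM; apply/negP.
  have /negPf-> : v \notin Z by apply/negP => /ZM; apply/negP.
  by rewrite subrr addr0.
have v'M : v' \in M by rewrite inM exch_refl.
apply/idP/idP => [/forallP/(_ M)|].
  by rewrite tight_in // tM v'M /= inM.
move=> h; apply/forallP => Z; apply/implyP => tZ; apply/implyP => v'Z.
have t1M : tight (shift x u v) M by rewrite tight_in.
have /andP[+ _] := tight_cap_cup x1B tZ t1M.
rewrite tight_in ?finset.subsetIr // => tZM.
by move: h => /forallP/(_ (Z :&: M)%SET); rewrite tZM !inE v'Z v'M /= => /andP[].
Qed.

(** No earlier [a.1] lies in the minimal tight set of a later [b.2], so by [exch_shift] each
    exchange leaves the later ones as they were at [x]. *)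
Lemma exchange_seq x (L : seq (V * V)) : int_base x ->
  all (fun a => exch x a.2 a.1) L ->
  pairwise (fun a b => ~~ exch x b.2 a.1) L ->
  int_base (fun t => x t + \sum_(a <- L) ((t == a.1)%:Z - (t == a.2)%:Z)).
Proof.
elim: L x => [|[u v] L IH] x xB.
  by move=> _ _; rewrite (_ : (fun t => _) = x) //; apply/funext => t; rewrite big_nil addr0.
rewrite /= => /andP[vu allL] /andP[uL pairL].
have same b : b \in L -> forall t, exch (shift x u v) b.2 t = exch x b.2 t.
  by move=> bL t; rewrite exch_shift //; apply: (allP uL).
rewrite (_ : (fun t => _) = fun t => shift x u v t +
  \sum_(a <- L) ((t == a.1)%:Z - (t == a.2)%:Z)); last first.
  by apply/funext => t; rewrite big_cons addrA.
apply: IH; first exact: shift_base.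
  by apply/allP => b bL; rewrite same //; apply: (allP allL).
rewrite (@eq_in_pairwise _ (mem L) _ (fun a b => ~~ exch x b.2 a.1)) //.
  by move=> a b aL bL /=; rewrite same.
Qed.

End IntegralBases.

(** * Positions in a sequence, and the arithmetic of chords *)

Lemma mem2_split (T : eqType) (a b : T) (t : seq T) : a \in t -> b \in t -> a != b ->
  exists s1 s2 s3, t = s1 ++ a :: s2 ++ b :: s3 \/ t = s1 ++ b :: s2 ++ a :: s3.
Proof.
case/splitPr=> t1 t2; rewrite mem_cat inE => /orP[|/orP[/eqP->|]]; last 2 first.
- by rewrite eqxx.
- by case/splitPr=> t3 t4 _; exists t1, t3, t4; left.
case/splitPr=> t3 t4 _; exists t3, t4, t2; right; by rewrite -catA.
Qed.

Lemma take_index_uniq (T : eqType) (a : T) (t1 t2 : seq T) :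
  uniq (t1 ++ a :: t2) ->
  (take (index a (t1 ++ a :: t2)) (t1 ++ a :: t2) = t1) *
  (index a (t1 ++ a :: t2) = size t1).
Proof.
rewrite cat_uniq /= negb_or => /and3P[_ /andP[/negPf at1 _] _].
have -> : index a (t1 ++ a :: t2) = size t1 by rewrite index_cat at1 /= eqxx addn0.
by rewrite take_size_cat.
Qed.

(** [C] and [K] stand for the cost and length of the negative closed walk. A piece of [n2 + 1 < K]
    arcs that costs at most [C] has mean cost below [C / K]. *)
Lemma chord_forward_ineq (K C C1 C2 n1 n2 : int) :
  C < 0 -> C2 <= C -> 0 <= n2 -> n2 + 1 < K ->
  K * (C1 + C2) - C * (n1 + (n2 + 1)) < K * C1 - C * n1.
Proof.
move=> C_neg le_C n2_ge0 lt_K; rewrite -subr_gt0.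
have -> : K * C1 - C * n1 - (K * (C1 + C2) - C * (n1 + (n2 + 1)))
        = K * (C - C2) + (- C) * (K - (n2 + 1)) by ring.
by rewrite ltr_wpDl ?mulr_ge0 ?mulr_gt0 ?subr_ge0 ?subr_gt0 ?oppr_gt0 //; lia.
Qed.

(** In the same notation, a piece of non-negative cost lies above the negative mean [C / K]. *)
Lemma chord_backward_ineq (K C C1 C2 n1 n2 : int) :
  C < 0 -> 0 <= C2 -> 0 <= n2 -> 0 <= K ->
  K * C1 - C * n1 < K * (C1 + C2) - C * (n1 + (n2 + 1)).
Proof.
move=> C_neg C2_ge0 n2_ge0 K_ge0; rewrite -subr_gt0.
have -> : K * (C1 + C2) - C * (n1 + (n2 + 1)) - (K * C1 - C * n1)
        = K * C2 + (- C) * (n2 + 1) by ring.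
by rewrite ltr_wpDl ?mulr_ge0 ?mulr_gt0 ?oppr_gt0 //; lia.
Qed.

(** * The residual digraph and augmentation along a negative closed walk *)

Section Augmentation.
Variables (V A : finType) (src tgt : A -> V) (f g : A -> \bar int).
Variables (p : {set V} -> \bar int) (c : A -> int -> int).
Hypothesis p_super : supermodular p.
Implicit Type z : A -> int.

Definition inflow z v : int :=
  \sum_e z e * ((v == tgt e)%:Z - (v == src e)%:Z).

Definition feasible z : Prop :=
  (forall e, ((f e <= (z e)%:E) && ((z e)%:E <= g e))%E) /\ int_base p (inflow z).

Let E : finType := (A + A + V * V)%type.

(* An arc [fwd e] or [bwd e] of the residual digraph increases or decreases the
   flow on [e] by one; the arc [exg u v] moves one unit of net in-flow from
   [v] to [u]. *)
Notation fwd e := (inl (inl e) : E).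
Notation bwd e := (inl (inr e) : E).
Notation exg u v := (inr (u, v) : E).

Definition res_tl (a : E) : V :=
  match a with inl (inl e) => src e | inl (inr e) => tgt e | inr (u, _) => u end.
Definition res_hd (a : E) : V :=
  match a with inl (inl e) => tgt e | inl (inr e) => src e | inr (_, v) => v end.

Variable z : A -> int.
Hypothesis z_feas : feasible z.

Definition res_cost (a : E) : int :=
  match a with
  | inl (inl e) => c e (z e + 1) - c e (z e)
  | inl (inr e) => c e (z e - 1) - c e (z e)
  | inr (_, _) => 0
  end.
Definition res_arc : pred E := fun a =>
  match a with
  | inl (inl e) => ((z e + 1)%:E <= g e)%E
  | inl (inr e) => (f e <= (z e - 1)%:E)%E
  | inr (u, v) => exch p (inflow z) v u
  end.

Local Notation rwalk := (walk res_tl res_hd res_arc).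
Local Notation rcost := (cost res_cost).

Lemma sum_res_arcs (h : E -> int) (s : seq E) : uniq s ->
  \sum_(a <- s) h a =
    \sum_e ((fwd e \in s)%:Z * h (fwd e) + (bwd e \in s)%:Z * h (bwd e)) +
    \sum_(b | inr b \in s) h (inr b).
Proof.
move=> us; rewrite big_uniq //= big_sumType /= big_sumType /= -addrA addrA.
congr (_ + _); rewrite big_split /=; congr (_ + _); rewrite big_mkcond;
  by apply: eq_bigr => e _; case: ifP => _; rewrite ?mul1r ?mul0r.
Qed.

Section NegativeWalk.
Variables (u : V) (s : seq E).
Hypotheses (ws : rwalk u s u) (neg_s : rcost s < 0)
  (min_s : forall u' s', rwalk u' s' u' -> (size s' < size s)%N -> 0 <= rcost s').
Hypothesis c_convex : forall e, ((z e + 1)%:E <= g e)%E -> (f e <= (z e - 1)%:E)%E ->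
  c e (z e) *+ 2 <= c e (z e + 1) + c e (z e - 1).

Let us : uniq s := minimal_negative_uniq ws neg_s min_s.

(** By convexity the two arcs together cost at least zero. Deleting both leaves two shorter closed
    walks, one of them still negative, against minimality. *)
Lemma opposite_arcs_not_both e : ~~ ((fwd e \in s) && (bwd e \in s)).
Proof.
apply/negP => /andP[se se'].
have cvx : 0 <= res_cost (fwd e) + res_cost (bwd e).
  have /allP Ps := walk_all ws.
  by have := c_convex (Ps _ se) (Ps _ se') => /=; lia.
have [] := @mem2_split _ (fwd e) (bwd e) s se se' isT => s1 [s2 [s3 def_s]].
(* [a] is whichever of the two arcs occurs first, so both orders are treated at once. *)
have [a [b [def_ab hab hba cab]]] : exists a b : E, [/\ s = s1 ++ a :: s2 ++ b :: s3,
    res_hd a = res_tl b, res_hd b = res_tl a &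
    res_cost a + res_cost b = res_cost (fwd e) + res_cost (bwd e)].
  by case: def_s => ->; [exists (fwd e), (bwd e) | exists (bwd e), (fwd e)];
     split=> //; rewrite addrC.
move: ws neg_s; rewrite def_ab => /walk_cat[m w1 /= /and3P[Pa /eqP tla]].
move=> /walk_cat[m' w2 /= /and3P[Pb /eqP tlb w3]].
have w2c : rwalk (res_hd a) s2 (res_hd a) by rewrite {2}hab tlb.
have w13 : rwalk u (s1 ++ s3) u.
  by apply/walk_cat; exists m => //; rewrite -tla -hba.
have := min_s w2c; have := min_s w13.
rewrite def_ab !size_cat /= !size_cat /= !costE => h1 h2 h3.
by clear - h1 h2 h3 cvx cab; lia.
Qed.

(** This is the cost of the part of [s] before [inr b] after the mean [rcost s / size s] is
    subtracted from every arc, scaled by [size s] to stay integral. *)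
Definition walk_key (b : V * V) : int :=
  (size s)%:Z * rcost (take (index (inr b : E) s) s) - rcost s * (index (inr b : E) s)%:Z.

(* A chord cuts the walk into two shorter ones; minimality of the walk makes
   the one containing the chord non-negative. *)
Lemma chord_key a b : inr a \in s -> inr b \in s -> a != b ->
  exch p (inflow z) b.2 a.1 -> walk_key b < walk_key a.
Proof.
case: a b => [ua va] [ub vb] sa sb ab /= chord.
have [] := @mem2_split _ (exg ua va) (exg ub vb) s sa sb ab => s1 [s2 [s3]].
case=> def_s; rewrite /walk_key.
(* The chord bypasses [s2]; the remaining closed walk has non-negative cost, so [s2] costs at most
   as much as [s]. *)
- have us1 := us; rewrite def_s in us1; have us2 := us1; rewrite -cat_cons catA in us2.
  move: ws; rewrite def_s => /walk_cat[m w1 /= /and3P[_ /eqP tla]].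
  move=> /walk_cat[m' w2 /= /and3P[_ /eqP tlb w3]].
  have w13 : rwalk u (s1 ++ exg ua vb :: s3) u.
    by apply/walk_cat; exists m => //=; rewrite chord tla eqxx.
  have := min_s w13; move: neg_s.
  rewrite def_s !(take_index_uniq us1) -cat_cons catA !(take_index_uniq us2).
  rewrite !size_cat /= !costE /= !add0r.
  move: (rcost s1) (rcost s2) (rcost s3) (size s1) (size s2) (size s3).
  move=> C1 C2 C3 n1 n2 n3 neg h.
  have {}h : 0 <= C1 + C3 by apply: h; clear; lia.
  have -> : (n1 + n2.+1)%N%:Z = n1%:Z + (n2%:Z + 1) by clear; lia.
  apply: chord_forward_ineq => //; clear - h; lia.
(* The chord closes [s2] to a shorter closed walk, so [s2] has non-negative cost. *)
- have us1 := us; rewrite def_s in us1; have us2 := us1; rewrite -cat_cons catA in us2.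
  move: ws; rewrite def_s => /walk_cat[m w1 /= /and3P[_ /eqP tlb]].
  move=> /walk_cat[m' w2 /= /and3P[_ /eqP tla w3]].
  have w2c : rwalk vb (s2 ++ [:: exg ua vb]) vb.
    by apply/walk_cat; exists m' => //=; rewrite chord tla !eqxx.
  have := min_s w2c; move: neg_s.
  rewrite def_s !(take_index_uniq us1) -cat_cons catA !(take_index_uniq us2).
  rewrite !size_cat /= !costE /= !add0r !addr0.
  move: (rcost s1) (rcost s2) (rcost s3) (size s1) (size s2) (size s3).
  move=> C1 C2 C3 n1 n2 n3 neg h.
  have {}h : 0 <= C2 by apply: h; clear; lia.
  have -> : (n1 + n2.+1)%N%:Z = n1%:Z + (n2%:Z + 1) by clear; lia.
  by apply: chord_backward_ineq.
Qed.

Definition augmented e : int := z e + ((fwd e \in s)%:Z - (bwd e \in s)%:Z).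

(** No edge is used in both directions, so its term changes by exactly the cost of its arc; exchange
    arcs are free. *)
Lemma augmented_cost : \sum_e c e (augmented e) = \sum_e c e (z e) + rcost s.
Proof.
rewrite /cost sum_res_arcs // [X in _ + (_ + X)]big1; last by case.
rewrite addr0 -big_split /=; apply: eq_bigr => e _.
have := opposite_arcs_not_both e; rewrite /augmented.
case: (fwd e \in s); case: (bwd e \in s) => //= _.
- by rewrite subr0 mul1r mul0r addr0 addrC subrK.
- by rewrite sub0r mul1r mul0r add0r addrC subrK.
- by rewrite subrr !mul0r !addr0.
Qed.

(** In increasing order of [walk_key] the exchanges of [s] meet the condition of [exchange_seq],
    because by [chord_key] a forbidden chord would reverse the order of two keys. *)
Lemma augmented_feasible : feasible augmented.
Proof.
have /allP Ps := walk_all ws; split=> [e|].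
  have /andP[fe ge] := z_feas.1 e.
  have := opposite_arcs_not_both e; rewrite /augmented.
  have := Ps (bwd e); have := Ps (fwd e).
  case: (fwd e \in s); case: (bwd e \in s) => //= Pf Pb _.
  - have {}Pf : ((z e + 1)%:E <= g e)%E := Pf isT.
    by rewrite subr0 Pf andbT; apply: (le_trans fe); rewrite lee_fin lerDl.
  - have {}Pb : (f e <= (z e - 1)%:E)%E := Pb isT.
    by rewrite sub0r Pb /=; apply: le_trans ge; rewrite lee_fin gerDl.
  - by rewrite subrr addr0 fe.
pose L := sort (relpre walk_key <=%O) [seq b <- enum {: V * V} | inr b \in s].
have memL b : (b \in L) = (inr b \in s) by rewrite mem_sort mem_filter mem_enum andbT.
have uL : uniq L by rewrite sort_uniq filter_uniq // enum_uniq.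
(* At each vertex the closed walk telescopes to zero, so the change of net in-flow along the edges
   is opposite to the contribution of the exchange arcs. *)
have -> : inflow augmented = fun t => inflow z t +
    \sum_(b <- L) ((t == b.1)%:Z - (t == b.2)%:Z).
  apply/funext => t; apply/eqP; rewrite -subr_eq0; apply/eqP.
  rewrite opprD addrA /inflow -sumrB.
  have := sum_walk (fun v => (t == v)%:Z) ws; rewrite subrr sum_res_arcs //= => sum0.
  rewrite -[RHS]sum0 -sumrN (big_uniq _ uL) /=; congr (_ + _).
    by apply: eq_bigr => e _; rewrite /augmented; ring.
  by apply: eq_big => [b|[u' v'] _]; rewrite ?memL // opprB.
apply: exchange_seq => //; first exact: z_feas.2.
  by apply/allP => -[u' v']; rewrite memL => /Ps.
have tr : transitive (relpre walk_key <=%O) by move=> ? ? ? /=; apply: le_trans.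
have : pairwise (relpre walk_key <=%O) L.
  rewrite -sorted_pairwise //; apply: sort_sorted => ? ? /=; exact: le_total.
have := uL; rewrite uniq_pairwise => pu pk.
have : pairwise [rel a b | (a != b) && relpre walk_key <=%O a b] L.
  by rewrite pairwise_relI pu.
apply: (@sub_in_pairwise _ (mem L)); last exact/allP.
move=> a b aL bL /= /andP[ab le_ab].
have sa : inr a \in s by rewrite -memL.
have sb : inr b \in s by rewrite -memL.
by apply/negP => /(chord_key sa sb ab); rewrite ltNge le_ab.
Qed.

End NegativeWalk.

(** Augmenting along a negative closed walk would give a cheaper feasible flow, so a potential
    exists; the three clauses are its inequalities on the three kinds of arcs. *)
Lemma optimal_potential :
  (forall z', feasible z' -> \sum_e c e (z e) <= \sum_e c e (z' e)) ->
  (forall e, ((z e + 1)%:E <= g e)%E -> (f e <= (z e - 1)%:E)%E ->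
    c e (z e) *+ 2 <= c e (z e + 1) + c e (z e - 1)) ->
  exists pi : V -> int,
    [/\ forall e, ((z e + 1)%:E <= g e)%E ->
          pi (tgt e) - pi (src e) <= c e (z e + 1) - c e (z e),
        forall e, (f e <= (z e - 1)%:E)%E ->
          c e (z e) - c e (z e - 1) <= pi (tgt e) - pi (src e)
      & forall u v, exch p (inflow z) v u -> pi v <= pi u].
Proof.
move=> z_opt c_cvx.
have [pi piP] : exists pi : V -> int, forall a, res_arc a ->
    pi (res_hd a) <= pi (res_tl a) + res_cost a.
  apply: potential_exists; apply: contrapT.
  move=> /minimal_negative_walk[u [s [ws neg_s min_s]]].
  have := z_opt _ (augmented_feasible ws neg_s min_s c_cvx).
  by rewrite (augmented_cost ws neg_s min_s c_cvx); lia.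
exists pi; split=> [e he|e he|u v he].
- by have := piP (fwd e) he => /=; lia.
- by have := piP (bwd e) he => /=; lia.
- by have := piP (exg u v) he => /=; lia.
Qed.

End Augmentation.

(** * Level sets of the potential, and the minimality of the base over them *)

Section LevelSets.
Variables (R : realDomainType) (V : finType) (p : {set V} -> \bar int).
Hypotheses (p_super : supermodular p) (p0 : p finset.set0 = 0%E).

(** By monotonicity the level set contains the minimal tight set of each of its elements, so it is a
    union of tight sets. *)
Lemma level_set_tight (x pi : V -> int) (t : int) : int_base p x ->
  (forall u v, exch p x v u -> pi v <= pi u) ->
  tight p x [set v | t <= pi v]%SET.
Proof.
move=> xB mono; have minM v := minimal_tight p_super v xB.
pose M v := projT1 (cid2 (minM v)).
have tM v : tight p x (M v) by rewrite /M; case: cid2.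
have inM v u : (u \in M v) = exch p x v u by rewrite /M; case: cid2.
have -> : [set v | t <= pi v]%SET = (\bigcup_(v | t <= pi v) M v)%SET.
  apply/setP => u; rewrite inE; apply/idP/finset.bigcupP => [tu|[v tv]].
    by exists u; rewrite ?inM ?exch_refl.
  by rewrite inM => /mono; apply: le_trans.
apply: (@big_ind _ (fun Z => is_true (tight p x Z))) => //.
  by rewrite /tight p0 /bsum big_set0.
by move=> X Y tX tY; have /andP[] := tight_cap_cup p_super xB tX tY.
Qed.

(* [\sum_v pi v * d v] is a combination of sums of [d] over level sets of [pi],
   with non-negative coefficients except for that of the whole ground set. *)
Lemma sum_by_level_sets (pi : V -> int) (d : V -> R) : \sum_v d v = 0 ->
  (forall t : int, 0 <= \sum_(v | t <= pi v) d v) ->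
  0 <= \sum_v (pi v)%:~R * d v.
Proof.
move=> d0 d_ge0; pose b := - \sum_v `|pi v|.
have b_le v : b <= pi v.
  rewrite /b (bigD1 v) //= opprD.
  have : 0 <= \sum_(i | i != v) `|pi i| by apply: sumr_ge0.
  by move: (bigop.body _ _ _); lia.
pose k v := absz (pi v - b)%R; have piE v : pi v = b + (k v)%:Z.
  by rewrite /k; have := b_le v; lia.
pose m := (\sum_v k v)%N; have k_le v : (k v <= m)%N by rewrite /m (bigD1 v) ?leq_addr.
(* [pi v - b] counts the levels [b + 1], ..., [b + m] that are at most [pi v]; the multiple [b] of
   the total of [d] vanishes. *)
have -> : \sum_v (pi v)%:~R * d v = \sum_(t < m) \sum_(v | b + t.+1%:Z <= pi v) d v.
  transitivity (\sum_v (k v)%:R * d v).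
    have := congr1 ( *%R (b%:~R : R)) d0; rewrite mulr0 mulr_sumr => sum0.
    by under eq_bigr do rewrite piE intrD mulrDl; rewrite big_split /= sum0 add0r.
  under [RHS]eq_bigr do rewrite big_mkcond.
  rewrite exchange_big /=; apply: eq_bigr => v _.
  rewrite -big_mkcond /= mulr_natl -[k v in LHS]card_ord -sumr_const.
  rewrite (big_ord_widen _ (fun=> d v) (k_le v)); apply: eq_bigl => t.
  by rewrite piE lerD2l lez_nat.
by apply: sumr_ge0 => t _; apply: d_ge0.
Qed.

(** The difference [y - x] has total zero and is non-negative on tight sets, in particular on the
    level sets of [pi]. *)
Lemma potential_face_min (x pi : V -> int) (y : V -> R) : int_base p x ->
  (forall u v, exch p x v u -> pi v <= pi u) ->
  \sum_v y v = (bsum x finset.setT)%:~R ->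
  (forall Z, tight p x Z -> (bsum x Z)%:~R <= \sum_(v in Z) y v) ->
  \sum_v (pi v)%:~R * (x v)%:~R <= \sum_v (pi v)%:~R * y v.
Proof.
move=> xB mono yV y_ge; rewrite -subr_ge0 -sumrB.
under eq_bigr do rewrite -mulrBr.
have bsumE (Z : {set V}) : (bsum x Z)%:~R = \sum_(v in Z) (x v)%:~R :> R.
  by rewrite /bsum rmorph_sum.
apply: sum_by_level_sets => [|t].
  rewrite sumrB yV bsumE; apply/eqP; rewrite subr_eq0; apply/eqP.
  by apply: eq_bigl => v; rewrite inE.
have := y_ge _ (level_set_tight t xB mono).
rewrite bsumE -subr_ge0 -sumrB.
by under eq_bigl do rewrite inE.
Qed.

End LevelSets.

(** * Minimizers of a strictly convex integer function minus a linear one *)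

Section StrictConvexity.
Variables (h : int -> int) (L : int).
Hypothesis h_convex : forall k : int, L < k -> h k - h (k - 1) < h (k + 1) - h k.

(** Integer slopes grow by at least one per step, so beyond [z + 1] the reduced value gains at least
    one per step. *)
Lemma convex_right (z d : int) (n : nat) : L <= z -> d <= h (z + 1) - h z ->
  h (z + 1) - d * (z + 1) + n%:Z <= h (z + 1 + n%:Z) - d * (z + 1 + n%:Z).
Proof.
move=> Lz dz.
have slope m : d + m%:Z <= h (z + 1 + m%:Z) - h (z + m%:Z).
  elim: m => [|m IH]; first by rewrite (_ : 0%:Z = 0) // !addr0.
  have := @h_convex (z + 1 + m%:Z).
  have -> : z + 1 + m%:Z - 1 = z + m%:Z by lia.
  have -> : z + 1 + m%:Z + 1 = z + 1 + m.+1%:Z by lia.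
  have -> : z + m.+1%:Z = z + 1 + m%:Z by lia.
  by lia.
elim: n => [|n IH]; first by rewrite (_ : 0%:Z = 0) // !addr0.
have := slope n.+1; rewrite (_ : z + n.+1%:Z = z + 1 + n%:Z); last by lia.
have -> : d * (z + 1 + n.+1%:Z) = d * (z + 1 + n%:Z) + d by lia.
by lia.
Qed.

Lemma convex_left (z d : int) (n : nat) : L <= z - 1 - n%:Z -> h z - h (z - 1) <= d ->
  h (z - 1) - d * (z - 1) + n%:Z <= h (z - 1 - n%:Z) - d * (z - 1 - n%:Z).
Proof.
move=> + dz.
have slope m : L <= z - 1 - m%:Z -> h (z - m%:Z) - h (z - 1 - m%:Z) <= d - m%:Z.
  elim: m => [|m IH] Lm; first by rewrite (_ : 0%:Z = 0) // !subr0.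
  have := @h_convex (z - 1 - m%:Z).
  have -> : z - 1 - m%:Z + 1 = z - m%:Z by lia.
  have -> : z - 1 - m%:Z - 1 = z - 1 - m.+1%:Z by lia.
  have -> : z - m.+1%:Z = z - 1 - m%:Z by lia.
  by lia.
elim: n => [|n IH] Ln; first by rewrite (_ : 0%:Z = 0) // !subr0 ?addr0.
have := slope n.+1 Ln; rewrite (_ : z - n.+1%:Z = z - 1 - n%:Z); last by lia.
have -> : d * (z - 1 - n.+1%:Z) = d * (z - 1 - n%:Z) - d by lia.
by have := IH; lia.
Qed.

(** When [z] minimizes [h k - d * k] on the integers from [a] on, this is the least minimizer:
    [z - 1] ties with [z] exactly when the slope between them is [d]. *)
Definition opt_lower (a z d : int) : int :=
  if (a < z) && (h z - h (z - 1) == d) then z - 1 else z.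
Definition opt_upper (b z d : int) : int :=
  if (z < b) && (h (z + 1) - h z == d) then z + 1 else z.

(** The slope conditions make [z] a minimizer; as slopes increase strictly, at most one of its two
    neighbours can tie with it. *)
Lemma opt_interval (a b z d : int) : L <= a -> a <= z <= b ->
  (z < b -> d <= h (z + 1) - h z) -> (a < z -> h z - h (z - 1) <= d) ->
  [/\ a <= opt_lower a z d <= z, z <= opt_upper b z d <= b,
      opt_upper b z d - opt_lower a z d <= 1 &
      forall k : int, a <= k <= b -> h z - d * z <= h k - d * k /\
        (h k - d * k = h z - d * z <-> opt_lower a z d <= k <= opt_upper b z d)].
Proof.
move=> La /andP[az zb] right left; have cvx := @h_convex z.
have lo : a <= opt_lower a z d <= z.
  by rewrite /opt_lower; case: ifP => [/andP[+ _]|_]; lia.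
have hi : z <= opt_upper b z d <= b.
  by rewrite /opt_upper; case: ifP => [/andP[+ _]|_]; lia.
split=> //.
  rewrite /opt_lower /opt_upper.
  by case: ifP => [/andP[+ /eqP]|_]; case: ifP => [/andP[+ /eqP]|_]; lia.
move=> k /andP[ak kb]; case: (ltgtP k z) => [ltz|gtz|->]; last first.
- by split=> //; split=> // _; lia.
- have ltzb : z < b by lia.
  have upE : opt_upper b z d = if h (z + 1) - h z == d then z + 1 else z.
    by rewrite /opt_upper ltzb.
  have := right ltzb; pose n := absz (k - z - 1)%R.
  have def_n : n%:Z = k - z - 1 by rewrite /n; lia.
  have := convex_right n (le_trans La az) (right ltzb).
  rewrite (_ : z + 1 + n%:Z = k); last by lia.
  have -> : d * (z + 1) = d * z + d by lia.
  move: upE; case: eqP => [e|ne] -> h1 h2; split; try lia.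
  by split=> [e2|/andP[_ k_le]]; [lia | have -> : k = z + 1; lia].
- have ltaz : a < z by lia.
  have lowE : opt_lower a z d = if h z - h (z - 1) == d then z - 1 else z.
    by rewrite /opt_lower ltaz.
  have := left ltaz; pose n := absz (z - 1 - k)%R.
  have def_n : n%:Z = z - 1 - k by rewrite /n; lia.
  have := @convex_left z d n; rewrite (_ : z - 1 - n%:Z = k); last by lia.
  move=> /(_ (le_trans La ak) (left ltaz)).
  have -> : d * (z - 1) = d * z - d by lia.
  move: lowE; case: eqP => [e|ne] -> h1 h2; split; try lia.
  by split=> [e2|/andP[k_ge _]]; [lia | have -> : k = z - 1; lia].
Qed.

End StrictConvexity.

(** * Decreasing comparison through rapidly growing weights *)

Section LexicographicWeights.
Variables (R : realType) (N : nat) (D : pred R) (phi : R -> int).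
Hypotheses (phi_gt0 : forall x, D x -> 0 < phi x)
  (phi_growth : forall x y, D x -> D y -> x < y -> N%:Z * phi x <= phi y).

(** Where the sequences first differ, the larger entry weighs at least [N] times the smaller one,
    which outweighs the fewer than [N] remaining terms, none heavier than their head. *)
Lemma seqlexi_sum_lt (s t : seqlexi R) : size s = size t -> (size s < N)%N ->
  sorted >=%R s -> sorted >=%R t -> all D s -> all D t -> (s < t)%O ->
  \sum_(x <- s) phi x < \sum_(x <- t) phi x.
Proof.
have ge_tr : transitive (>=%R : rel R) by move=> ? ? ? h1 h2; apply: le_trans h2 h1.
elim: s t => [|x s IH] [|y t] //= [sz] szN; rewrite ltxi_cons.
move=> sort_s sort_t /andP[Dx Ds] /andP[Dy Dt] /andP[le_xy].
rewrite !big_cons; have [->|ne_xy] := eqVneq x y.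
  rewrite lexx /= ltrD2l => lt_st; apply: IH => //.
  - by apply: ltnW.
  - exact: path_sorted sort_s.
  - exact: path_sorted sort_t.
move=> _; have lt_xy : x < y by rewrite lt_neqAle ne_xy.
have phi_mono x' : x' \in s -> phi x' <= phi x.
  move=> x's; have Dx' := allP Ds _ x's.
  move: sort_s; rewrite (path_sortedE ge_tr) => /andP[/allP/(_ _ x's)] /=.
  rewrite le_eqVlt => /orP[/eqP-> //|lt_x'] _.
  have := phi_growth Dx' Dx lt_x'; have := phi_gt0 Dx'; move: szN; clear.
  by move: (phi x') (phi x) => a b; nia.
have sum_s : \sum_(x' <- s) phi x' <= (size s)%:Z * phi x.
  apply: (@le_trans _ _ (\sum_(x' <- s) phi x)).
    by rewrite big_seq [leRHS]big_seq; apply: ler_sum.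
  by rewrite big_const_seq count_predT iter_addr_0 -natz mulr_natl.
have sum_t : 0 <= \sum_(x' <- t) phi x'.
  by rewrite big_seq; apply: sumr_ge0 => x' x't; apply/ltW/phi_gt0/(allP Dt).
have := phi_growth Dx Dy lt_xy; have := phi_gt0 Dx.
move: sum_s sum_t szN; clear; move: (bigop.body _ _ _) (bigop.body _ _ _) => a b.
by move: (phi x) (phi y) (size s) => c d n; nia.
Qed.

Variables (A : finType) (F : {set A}).
Hypothesis F_small : (#|F| < N)%N.

Let size_sd (x : {ffun A -> R}) : size (sorted_decr F x) = #|F|.
Proof. by rewrite size_sort size_map -cardE. Qed.

Let sum_sd (x : {ffun A -> R}) :
  \sum_(r <- sorted_decr F x) phi r = \sum_(e in F) phi (x e).
Proof.
rewrite /sorted_decr (perm_big [seq x e | e <- enum F]) /=.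
  by rewrite big_map big_enum.
by rewrite perm_sort.
Qed.

Lemma dec_smaller_sum (x y : {ffun A -> R}) :
  (forall e, e \in F -> D (x e) && D (y e)) ->
  dec_smaller F x y <-> \sum_(e in F) phi (x e) < \sum_(e in F) phi (y e).
Proof.
move=> Dxy; have ge_tot : total (>=%R : rel R) by move=> ? ?; apply: le_total.
have Dsd (z : {ffun A -> R}) : (forall e, e \in F -> D (z e)) -> all D (sorted_decr F z).
  move=> Dz; apply/allP => r; rewrite mem_sort => /mapP[e]; rewrite mem_enum => eF ->.
  exact: Dz.
have Dx : all D (sorted_decr F x) by apply: Dsd => e /Dxy/andP[].
have Dy : all D (sorted_decr F y) by apply: Dsd => e /Dxy/andP[].
have lt_sum (z z' : {ffun A -> R}) : all D (sorted_decr F z) -> all D (sorted_decr F z') ->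
    dec_smaller F z z' -> \sum_(e in F) phi (z e) < \sum_(e in F) phi (z' e).
  move=> Dz Dz' lt_zz'; rewrite -!sum_sd; apply: seqlexi_sum_lt => //.
  - by rewrite !size_sd.
  - by rewrite size_sd.
  - exact: sort_sorted.
  - exact: sort_sorted.
split=> [|lt_xy]; first exact: lt_sum.
rewrite /dec_smaller ltNge le_eqVlt; apply/negP => /orP[/eqP e|lt_yx].
  by move: lt_xy; rewrite -!sum_sd e ltxx.
by have := lt_trans lt_xy (lt_sum _ _ Dy Dx lt_yx); rewrite ltxx.
Qed.

End LexicographicWeights.

(** * Passage between integer and real data *)

Section IntegerData.
Variables (R : realType) (V A : finType) (src tgt : A -> V).
Variables (f g : A -> \bar int) (p : {set V} -> \bar int).

Lemma er_map_intr_le (a : \bar int) (m : int) :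
  ((er_map intr a <= (m%:~R : R)%:E) = (a <= m%:E))%E.
Proof. by case: a => [a| |] /=; rewrite ?lee_fin ?ler_int ?leye_eq ?leNye. Qed.

Lemma er_map_intr_ge (a : \bar int) (m : int) :
  (((m%:~R : R)%:E <= er_map intr a) = (m%:E <= a))%E.
Proof. by case: a => [a| |] /=; rewrite ?lee_fin ?ler_int ?leeNy_eq ?leey. Qed.

Lemma er_map_intr_eq (a : \bar int) (m : int) :
  er_map intr a = (m%:~R : R)%:E <-> a = m%:E.
Proof.
case: a => [a| |] //=; split=> [[] /(@intr_inj R)->|[->]] //.
Qed.

Lemma net_inflow_int (z : A -> int) (v : V) :
  net_inflow src tgt [ffun e => (z e)%:~R : R] v = (inflow src tgt z v)%:~R.
Proof.
rewrite ffunE /inflow [X in X - _]big_mkcond [X in _ - X]big_mkcond -sumrB rmorph_sum /=.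
apply: eq_bigr => e _; rewrite ffunE intrM intrB ![v == _]eq_sym.
by case: eqP => _; case: eqP => _ /=; rewrite ?subrr ?mulr0 ?subr0 ?mulr1 ?sub0r ?mulrN1.
Qed.

Lemma base_polyhedron_int (x : V -> int) :
  base_polyhedron p [ffun v => (x v)%:~R : R] <-> int_base p x.
Proof.
have sumE (Z : {set V}) :
    \sum_(v in Z) [ffun v => (x v)%:~R : R] v = (bsum x Z)%:~R.
  by rewrite /bsum rmorph_sum; apply: eq_bigr => v _; rewrite ffunE.
have sumVE : \sum_v [ffun v => (x v)%:~R : R] v = (bsum x finset.setT)%:~R.
  by rewrite -sumE; apply: eq_bigl => v; rewrite inE.
rewrite /base_polyhedron /= sumVE; split=> [[/esym/er_map_intr_eq pV pZ]|[/eqP pV pZ]].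
  split=> [|Z]; first by rewrite /tight pV.
  have [->|] := eqVneq Z finset.setT; first by rewrite pV.
  by rewrite -properT => /pZ; rewrite sumE er_map_intr_le.
split=> [|Z _]; first by rewrite pV.
by rewrite sumE er_map_intr_le.
Qed.

Lemma base_flow_int (z : A -> int) :
  base_flow src tgt f g (base_polyhedron p) [ffun e => (z e)%:~R : R] <->
  feasible src tgt f g p z.
Proof.
rewrite /base_flow /feasible /=.
have -> : net_inflow src tgt [ffun e => (z e)%:~R : R] =
    [ffun v => (inflow src tgt z v)%:~R : R].
  by apply/ffunP => v; rewrite net_inflow_int ffunE.
rewrite base_polyhedron_int; split=> -[bd xB]; split=> // e; have := bd e;
  by rewrite ffunE er_map_intr_le er_map_intr_ge.
Qed.

Lemma integral_point_int (x : {ffun A -> R}) : integral_points x ->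
  exists z : A -> int, x = [ffun e => (z e)%:~R].
Proof.
move=> xi; exists (fun e => Num.floor (x e)); apply/ffunP => e.
by rewrite ffunE floorK.
Qed.

Lemma int_integral_point (z : A -> int) : integral_points [ffun e => (z e)%:~R : R].
Proof. by move=> e; rewrite ffunE; apply: intr_int. Qed.

(** Summation by parts; it splits a total cost into reduced edge costs and the potential of the net
    in-flow. *)
Lemma sum_potential_inflow (pi : V -> int) (z : A -> int) :
  \sum_e (pi (tgt e) - pi (src e)) * z e = \sum_v pi v * inflow src tgt z v.
Proof.
under [RHS]eq_bigr do rewrite mulr_sumr.
rewrite exchange_big /=; apply: eq_bigr => e _.
have pick u : \sum_v pi v * (v == u)%:Z = pi u.
  rewrite (bigD1 u) //= eqxx mulr1 big1 ?addr0 // => v /negPf->.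
  by rewrite mulr0.
rewrite -[in LHS]pick -[X in (_ - X) * _]pick -sumrB mulr_suml.
by apply: eq_bigr => v _; rewrite -mulrBr -mulrA; congr (_ * _); rewrite mulrC.
Qed.

End IntegerData.

(** * Growth and convexity of the exponential cost *)

Section ExponentialCost.
Variables (N : nat) (L : int).
Hypothesis N_gt1 : (1 < N)%N.

Definition exp_cost (k : int) : int := (N ^ absz (k - L)%R)%N%:Z.

Lemma exp_costS k : L <= k -> exp_cost (k + 1) = N%:Z * exp_cost k.
Proof.
move=> Lk; rewrite /exp_cost -PoszM -expnS; congr (Posz (N ^ _)); lia.
Qed.

Lemma exp_cost_gt0 k : 0 < exp_cost k.
Proof. by rewrite /exp_cost ltz_nat expn_gt0; lia. Qed.

Lemma exp_cost_growth k l : L <= k -> k < l -> N%:Z * exp_cost k <= exp_cost l.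
Proof.
move=> Lk kl; rewrite -exp_costS // /exp_cost lez_nat leq_exp2l //; lia.
Qed.

Lemma exp_cost_convex k : L < k ->
  exp_cost k - exp_cost (k - 1) < exp_cost (k + 1) - exp_cost k.
Proof.
move=> Lk; have Lk1 : L <= k - 1 by lia.
have := exp_costS Lk1; rewrite subrK exp_costS; last by lia.
by have := exp_cost_gt0 (k - 1); move: (exp_cost (k - 1)) (exp_cost k) => a b; nia.
Qed.

End ExponentialCost.

(** * Description of the decreasingly minimal integral base-flows *)

Theorem theorem1p1 (R : realType) (V A : finType) (src tgt : A -> V)
    (loopless : forall e, src e != tgt e)
    (f g : A -> \bar int)
    (f_lt_pinfty : below_pinfty f) (g_gt_ninfty : above_ninfty g)
    (f_le_g : forall e, (f e <= g e)%E)
    (B : set {ffun V -> R}) (B_base : integral_base_polyhedron B)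
    (Q_nonempty : base_flow src tgt f g B !=set0)
    (F : {set A})
    (F_finite : forall e, e \in F ->
       f e \is a fin_num /\ g e \is a fin_num) :
  exists (Bface : set {ffun V -> R}) (fs gs : A -> \bar int),
    [/\ face B Bface,
        below_pinfty fs /\ above_ninfty gs,
        forall e, (f e <= fs e)%E /\ (fs e <= gs e)%E /\ (gs e <= g e)%E,
        forall z, (base_flow src tgt f g B `&` integral_points) z ->
          (dec_min F (base_flow src tgt f g B `&` integral_points) z <->
           (base_flow src tgt fs gs Bface `&` integral_points) z)
      & forall e, e \in F -> (0 <= gs e - fs e)%E /\ (gs e - fs e <= 1)%E].
Proof.
have [[x0 Sx0]|no_int] := pselect (exists x, (base_flow src tgt f g B `&` integral_points) x);
  last first.
  (* Without integral points the equivalence is vacuous; [B] is a face of itself, and both bounds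
     are taken equal to [f] on [F]. *)
  exists B, f, (fun e => if e \in F then f e else g e); split.
  - split; first by have [x [_ xB]] := Q_nonempty; exists (net_inflow src tgt x).
    exists 0; apply/seteqP; split=> [y yB|y []//]; split=> // y' _.
    by rewrite !big1 // => v _; rewrite ffunE mul0r.
  - split=> // e; case: ifP => [/F_finite[fe _]|_]; last exact: g_gt_ninfty.
    by case: (f e) fe.
  - by move=> e; case: ifP => _; rewrite ?lexx ?f_le_g.
  - by move=> z Sz; exfalso; apply: no_int; exists z.
  - move=> e eF; rewrite eF; have [fe _] := F_finite _ eF.
    by case: (f e) fe => // a _; rewrite -EFinB subrr !lee_fin.
have [p [_ p0 _ p_super def_B]] : exists p : {set V} -> \bar int,
    [/\ below_pinfty p, p finset.set0 = 0%E, p [set: V]%SET \is a fin_num,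
        supermodular p & B = base_polyhedron p].
  by case: B_base => // B0; case: Sx0 => -[_]; rewrite B0.
(* [N] exceeds the length of the compared sequences and is at least two even for empty [F]; [L] lies
   below [f] on [F]. *)
subst B; pose N := #|F|.+2; pose L := - \sum_(e in F) `|fine (f e)|.
have N_gt1 : (1 < N)%N by [].
pose h := exp_cost N L; pose c e k := if e \in F then h k else 0.
have fF e : e \in F -> f e = (fine (f e))%:E by case/F_finite => + _; case: (f e).
have gF e : e \in F -> g e = (fine (g e))%:E by case/F_finite => _; case: (g e).
have L_le e : e \in F -> L <= fine (f e).
  move=> eF; rewrite /L (bigD1 e) //= opprD.
  have : 0 <= \sum_(i in F | i != e) `|fine (f i)| by apply: sumr_ge0.
  by move: (bigop.body _ _ _) => s; lia.
(* Even if [Q] is unbounded an optimum exists, since the costs are non-negative integers. *)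
have [z0 z0_feas z0_min] : exists2 z, feasible src tgt f g p z &
    forall z', feasible src tgt f g p z' -> \sum_e c e (z e) <= \sum_e c e (z' e).
  apply: (@int_min_exists _ _ _ 0) => [|z _].
    have [x0B x0i] := Sx0; have [z0 def_x0] := integral_point_int x0i.
    by exists z0; apply/(base_flow_int R); rewrite -def_x0.
  by apply: sumr_ge0 => e _; rewrite /c; case: ifP.
have bdF z e : feasible src tgt f g p z -> e \in F -> fine (f e) <= z e <= fine (g e).
  by move=> [bd _] eF; have := bd e; rewrite (fF _ eF) (gF _ eF) !lee_fin.
have c_cvx e : ((z0 e + 1)%:E <= g e)%E -> (f e <= (z0 e - 1)%:E)%E ->
    c e (z0 e) *+ 2 <= c e (z0 e + 1) + c e (z0 e - 1).
  rewrite /c; case: ifP => [eF _|]; last by rewrite mul0rn.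
  rewrite (fF _ eF) lee_fin => Lz; have := L_le _ eF => Lf.
  by have := @exp_cost_convex N L N_gt1 (z0 e); rewrite -/h; lia.
have [pi [pi_fwd pi_bwd pi_mono]] := optimal_potential p_super z0_feas z0_min c_cvx.
pose delta e := pi (tgt e) - pi (src e).
(* Off [F] the reduced cost is linear: for [delta e = 0] every value is optimal, otherwise only
   [z0 e], which then sits at a bound. *)
pose fs e : \bar int := if e \in F then (opt_lower h (fine (f e)) (z0 e) (delta e))%:E
  else if delta e == 0 then f e else (z0 e)%:E.
pose gs e : \bar int := if e \in F then (opt_upper h (fine (g e)) (z0 e) (delta e))%:E
  else if delta e == 0 then g e else (z0 e)%:E.
have intervalF e (eF : e \in F) :
    [/\ fine (f e) <= opt_lower h (fine (f e)) (z0 e) (delta e) <= z0 e,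
        z0 e <= opt_upper h (fine (g e)) (z0 e) (delta e) <= fine (g e),
        opt_upper h (fine (g e)) (z0 e) (delta e) -
        opt_lower h (fine (f e)) (z0 e) (delta e) <= 1 &
      forall k : int, fine (f e) <= k <= fine (g e) ->
        h (z0 e) - delta e * z0 e <= h k - delta e * k /\
        (h k - delta e * k = h (z0 e) - delta e * z0 e <->
         opt_lower h (fine (f e)) (z0 e) (delta e) <= k <=
         opt_upper h (fine (g e)) (z0 e) (delta e))].
  apply: (opt_interval (exp_cost_convex N_gt1) (L_le e eF) (bdF _ _ z0_feas eF)) => lt_z.
    have := pi_fwd e; rewrite (gF _ eF) lee_fin /c eF; apply; lia.
  have := pi_bwd e; rewrite (fF _ eF) lee_fin /c eF; apply; lia.
have edge_opt z e : feasible src tgt f g p z ->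
    c e (z0 e) - delta e * z0 e <= c e (z e) - delta e * z e /\
    (c e (z e) - delta e * z e = c e (z0 e) - delta e * z0 e <->
     ((fs e <= (z e)%:E) && ((z e)%:E <= gs e))%E).
  move=> zf; rewrite /c /fs /gs; case: ifP => [eF|eF].
    have [_ _ _ /(_ _ (bdF _ _ zf eF))] := intervalF e eF.
    by rewrite !lee_fin.
  rewrite !sub0r; have [-> |d0] := eqVneq (delta e) 0.
    by rewrite !mul0r; split=> //; split=> // _; exact: zf.1.
  rewrite -eq_le eqe.
  (* If [z e] lies below [z0 e], then [z0 e] can decrease, which forces [0 <= delta e]; the other
     case is symmetric. *)
  have sign : delta e * z e <= delta e * z0 e.
    have := pi_fwd e; have := pi_bwd e; have := z0_feas.1 e; have := zf.1 e.
    rewrite /c eF subrr -/(delta e) => /andP[fz zg] /andP[fz0 z0g] bwd fwd.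
    have [le_z|lt_z|->//] := ltgtP (z e) (z0 e).
      have dg : 0 <= delta e by apply: bwd; apply: (le_trans fz); rewrite lee_fin; lia.
      by apply: ler_wpM2l => //; apply: ltW.
    have dl : delta e <= 0 by apply: fwd; apply: le_trans zg; rewrite lee_fin; lia.
    by apply: ler_wnM2l => //; apply: ltW.
  rewrite lerN2; split=> //; split=> [/oppr_inj/(mulfI d0)->|/eqP<-] //.
(* [z0] minimizes the reduced cost of every edge as well as the potential of the
   net in-flow, so [z] is optimal iff it minimizes each of them. *)
have costE z : \sum_e c e (z e) = \sum_e (c e (z e) - delta e * z e) +
    \sum_v pi v * inflow src tgt z v.
  by rewrite -sum_potential_inflow sumrB subrK.
pose x0v : {ffun V -> R} := [ffun v => (inflow src tgt z0 v)%:~R].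
have x0vB : base_polyhedron p x0v by apply/base_polyhedron_int; exact: z0_feas.2.
have face_min y : base_polyhedron p y ->
    \sum_v (pi v)%:~R * x0v v <= \sum_v (pi v)%:~R * y v.
  move=> [yV yZ]; under eq_bigr do rewrite ffunE.
  apply: (potential_face_min p_super p0 z0_feas.2 pi_mono).
    have [/eqP tV _] := z0_feas.2.
    by move: yV; rewrite tV => -[->].
  move=> Z /eqP tZ; have [->|] := eqVneq Z finset.setT.
    have [/eqP tV _] := z0_feas.2; move: yV; rewrite tV => -[<-].
    by rewrite le_eqVlt; apply/orP; left; apply/eqP; apply: eq_bigl => v; rewrite inE.
  by rewrite -properT => /yZ; rewrite tZ lee_fin.
have sum_piE z : \sum_v (pi v)%:~R * net_inflow src tgt [ffun e => (z e)%:~R : R] v =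
    (\sum_v pi v * inflow src tgt z v)%:~R.
  by rewrite rmorph_sum /=; apply: eq_bigr => v _; rewrite net_inflow_int intrM.
have sum_pi0E : \sum_v (pi v)%:~R * x0v v = (\sum_v pi v * inflow src tgt z0 v)%:~R.
  by rewrite rmorph_sum /=; apply: eq_bigr => v _; rewrite ffunE intrM.
pose C := [set x : {ffun V -> R} | base_polyhedron p x /\
   forall y, base_polyhedron p y -> \sum_v (pi v)%:~R * x v <= \sum_v (pi v)%:~R * y v].
have fs_gs e : (f e <= fs e)%E /\ (fs e <= gs e)%E /\ (gs e <= g e)%E.
  rewrite /fs /gs; case: ifP => [eF|_].
    have [/andP[? ?] /andP[? ?] _ _] := intervalF e eF.
    split; first by rewrite [leLHS](fF _ eF) lee_fin.
    split; last by rewrite [leRHS](gF _ eF) lee_fin.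
    by rewrite lee_fin; lia.
  by case: ifP => _; have /andP[? ?] := z0_feas.1 e; rewrite ?lexx ?f_le_g.
exists C, fs, gs; split=> //.
- split; first by exists x0v.
  exists [ffun v => (pi v)%:~R].
  have piE (y : {ffun V -> R}) : \sum_v [ffun v => (pi v)%:~R : R] v * y v =
      \sum_v (pi v)%:~R * y v by apply: eq_bigr => v _; rewrite ffunE.
  by apply/seteqP; split=> y [yB ymin]; split=> // y' y'B;
    have := ymin _ y'B; rewrite !piE.
- split=> e; rewrite /fs /gs; case: ifP => // _; case: ifP => // _.
- have ffun_int := @integral_point_int R A.
  (* [Num.floor] carries [h] over to reals; the growth bound holds on [D], which contains the values
     of feasible integral flows on [F]. *)
  pose phi (r : R) : int := h (Num.floor r).
  pose D : pred R := fun r => (r \is a Num.int) && (L <= Num.floor r).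
  have phi_gt0 r : D r -> 0 < phi r by move=> _; apply: exp_cost_gt0.
  have phi_growth r r' : D r -> D r' -> r < r' -> N%:Z * phi r <= phi r'.
    move=> /andP[ri Lr] /andP[ri' _] lt_rr'; apply: exp_cost_growth => //.
    by rewrite -(ltr_int R) !floorK.
  have DF z e : feasible src tgt f g p z -> e \in F -> D ([ffun e => (z e)%:~R] e).
    move=> zf eF; rewrite /D ffunE intr_int intrKfloor /=.
    by have := bdF _ _ zf eF; have := L_le _ eF; lia.
  have phiE z : \sum_(e in F) phi ([ffun e => (z e)%:~R] e) = \sum_e c e (z e).
    rewrite /c -big_mkcond; apply: eq_bigr => e _.
    by rewrite /phi ffunE intrKfloor.
  have smallerE z z' : feasible src tgt f g p z -> feasible src tgt f g p z' ->
      dec_smaller F [ffun e => (z e)%:~R : R] [ffun e => (z' e)%:~R] <->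
      \sum_e c e (z e) < \sum_e c e (z' e).
    move=> zf zf'; rewrite -!phiE.
    apply: (@dec_smaller_sum _ N D) => // e eF.
    by apply/andP; split; apply: DF.
  move=> y [yB /ffun_int[z def_y]]; subst y; move: yB => /base_flow_int zf.
  have minE : dec_min F (base_flow src tgt f g (base_polyhedron p) `&` integral_points)
      [ffun e => (z e)%:~R : R] <-> \sum_e c e (z e) <= \sum_e c e (z0 e).
    split=> [[_ z_min]|le_z0].
      rewrite leNgt; apply/negP => /(smallerE _ _ z0_feas zf).
      apply: (z_min [ffun e => (z0 e)%:~R : R]).
      by split; [apply/base_flow_int | apply: int_integral_point].
    split; first by split; [apply/base_flow_int | apply: int_integral_point].
    move=> y [yB /ffun_int[z' def_y]]; subst y; move: yB => /base_flow_int zf'.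
    move=> /(smallerE _ _ zf' zf).
    by have := z0_min _ zf'; lia.
  rewrite minE !costE.
  set S := \sum_e (c e (z e) - _); set S0 := \sum_e (c e (z0 e) - _).
  set T := \sum_v _; set T0 := \sum_v _.
  have le_S : S0 <= S by apply: ler_sum => e _; have [] := edge_opt z e zf.
  have inflowE : net_inflow src tgt [ffun e => (z e)%:~R : R] =
      [ffun v => (inflow src tgt z v)%:~R].
    by apply/ffunP => v; rewrite net_inflow_int ffunE.
  have zB : base_polyhedron p (net_inflow src tgt [ffun e => (z e)%:~R : R]).
    by rewrite inflowE; apply/base_polyhedron_int; exact: zf.2.
  have le_T : T0 <= T by have := face_min _ zB; rewrite sum_piE sum_pi0E ler_int.
  split=> [le_ST|[[bd [_ zC]] _]].
    split; last exact: int_integral_point.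
    split=> [e|].
      rewrite ffunE er_map_intr_le er_map_intr_ge; apply/(edge_opt z e zf).2.
      (* From [S0 <= S], [T0 <= T] and [S + T <= S0 + T0] both are equalities, so every edge attains
         its least reduced cost. *)
      have S_eq : S - S0 = 0 by lia.
      move: S_eq; rewrite /S /S0 -sumrB => /eqP; rewrite psumr_eq0; last first.
        by move=> i _; rewrite subr_ge0; have [] := edge_opt z i zf.
      by move=> /allP/(_ e); rewrite mem_index_enum subr_eq0 => /(_ isT)/eqP.
    split=> // y /face_min; apply: le_trans.
    by rewrite sum_piE sum_pi0E ler_int -/T -/T0; lia.
  have S_eq : S = S0.
    apply: eq_bigr => e _; apply/(edge_opt z e zf).2.
    by have := bd e; rewrite ffunE er_map_intr_le er_map_intr_ge.
  (* Testing minimality in the face against the net in-flow of [z0] gives [T <= T0]. *)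
  have := zC _ x0vB; rewrite sum_piE sum_pi0E ler_int -/T -/T0 => le_TT0.
  by rewrite S_eq lerD2l.
- move=> e eF; rewrite /fs /gs eF; have [/andP[? ?] /andP[? ?] ? _] := intervalF e eF.
  by rewrite -EFinB !lee_fin; split=> //; lia.
Qed.
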